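(* For any right-angled Artin group $\Gamma$ there exists an integer $n\geq 1$ such that $\Gamma$ admits a properly discontinuous action by affine transformations on $\mathbb{R}^n$.
   Context: A right-angled Artin group is a group defined from a finite simplicial graph by one generator for each vertex, with the relations that two generators commute whenever the corresponding vertices are joined by an edge. A proper affine action of a discrete group $\Gamma$ on $\mathbb{R}^n$ is a homomorphism from $\Gamma$ to the group of affine transformations of $\mathbb{R}^n$ such that for every compact $\mathscr{C}\subset\mathbb{R}^n$, the set of $\gamma\in\Gamma$ with $\gamma\cdot\mathscr{C}\cap\mathscr{C}\neq\varnothing$ is finite. *)

(* Defs.v *)
From HB Require Import structures.
From mathcomp Require Import all_boot all_order all_algebra.
From mathcomp Require Import all_classical all_reals all_analysis.

Set Implicit Arguments.
Unset Strict Implicit.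
Unset Printing Implicit Defensive.

Import Order.TTheory GRing.Theory Num.Theory.
Import numFieldNormedType.Exports.

Local Open Scope classical_set_scope.
Local Open Scope quotient_scope.
Local Open Scope ring_scope.

Section RightAngledArtin.
Variables (V : finType) (e : rel V).

(* The letter (v, true) stands for the generator v, and (v, false) for its
   inverse. *)
Definition word := seq (V * bool).

(* The congruence on words generated by free cancellation and by the
   relations u v = v u for u, v adjacent. *)
Inductive word_cong : word -> word -> Prop :=
| word_cong_refl w : word_cong w w
| word_cong_sym w1 w2 : word_cong w1 w2 -> word_cong w2 w1
| word_cong_trans w1 w2 w3 :
    word_cong w1 w2 -> word_cong w2 w3 -> word_cong w1 w3
| word_cong_cat w1 w2 w1' w2' :
    word_cong w1 w1' -> word_cong w2 w2' -> word_cong (w1 ++ w2) (w1' ++ w2')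
| word_cong_cancel v b : word_cong [:: (v, b); (v, ~~ b)] [::]
| word_cong_comm u v : e u v ->
    word_cong [:: (u, true); (v, true)] [:: (v, true); (u, true)].

Definition word_eqv : rel word := fun w1 w2 => `[< word_cong w1 w2 >].

Fact word_eqv_refl : reflexive word_eqv.
Proof. by move=> w; apply/asboolP; exact: word_cong_refl. Qed.

Fact word_eqv_sym : symmetric word_eqv.
Proof. by move=> w1 w2; apply/asboolP/asboolP; exact: word_cong_sym. Qed.

Fact word_eqv_trans : transitive word_eqv.
Proof.
move=> w2 w1 w3 /asboolP h12 /asboolP h23.
by apply/asboolP; exact: word_cong_trans h12 h23.
Qed.

Canonical word_equiv := EquivRel word_eqv
  word_eqv_refl word_eqv_sym word_eqv_trans.

Definition raag := {eq_quot word_equiv}.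

HB.instance Definition _ := Choice.on raag.
HB.instance Definition _ := EqQuotient.on raag.

Lemma raag_eqP w1 w2 : reflect (word_cong w1 w2) (\pi_raag w1 == \pi_raag w2).
Proof. by rewrite eqmodE; exact: asboolP. Qed.

Definition word_inv (w : word) : word := rev [seq (x.1, ~~ x.2) | x <- w].

Definition raag_one : raag := \pi_raag [::].
Definition raag_mul (g h : raag) : raag := \pi_raag (repr g ++ repr h).
Definition raag_inv (g : raag) : raag := \pi_raag (word_inv (repr g)).

Lemma word_cong_repr w : word_cong (repr (\pi_raag w)) w.
Proof. by apply/raag_eqP; rewrite reprK. Qed.

Lemma raag_mul_pi w1 w2 :
  raag_mul (\pi_raag w1) (\pi_raag w2) = \pi_raag (w1 ++ w2).
Proof.
by apply/eqP/raag_eqP; apply: word_cong_cat; exact: word_cong_repr.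
Qed.

Lemma word_cong_mulwV w : word_cong (w ++ word_inv w) [::].
Proof.
elim: w => [|[v b] w IHw]; first exact: word_cong_refl.
rewrite /word_inv /= rev_cons -/(word_inv w) -cats1.
apply: word_cong_trans (word_cong_cancel v b).
apply: (@word_cong_cat [:: (v, b)] _ [:: (v, b)] [:: (v, ~~ b)]).
  exact: word_cong_refl.
rewrite catA; apply: (@word_cong_cat _ _ [::]) => //; exact: word_cong_refl.
Qed.

Lemma word_invK : involutive word_inv.
Proof.
rewrite /word_inv => w; rewrite map_rev revK -map_comp -[RHS]map_id.
by apply: eq_map => -[v b] /=; rewrite negbK.
Qed.

Fact raag_mulA : associative raag_mul.
Proof.
elim/quotW=> x; elim/quotW=> y; elim/quotW=> z.
by rewrite (raag_mul_pi y z) (raag_mul_pi x y) !raag_mul_pi catA.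
Qed.

Fact raag_mul1g : left_id raag_one raag_mul.
Proof. by move=> x; rewrite -[x]reprK raag_mul_pi. Qed.

Fact raag_mulg1 : right_id raag_one raag_mul.
Proof. by move=> x; rewrite -[x]reprK raag_mul_pi cats0. Qed.

Fact raag_mulgV : right_inverse raag_one raag_inv raag_mul.
Proof.
move=> x; rewrite -[x in raag_mul x]reprK raag_mul_pi.
by apply/eqP/raag_eqP; exact: word_cong_mulwV.
Qed.

Fact raag_mulVg : left_inverse raag_one raag_inv raag_mul.
Proof.
move=> x; rewrite -[x in raag_mul _ x]reprK raag_mul_pi.
apply/eqP/raag_eqP; rewrite -[X in _ ++ X]word_invK.
exact: word_cong_mulwV.
Qed.

HB.instance Definition _ := isGroup.Build raag
  raag_mulA raag_mul1g raag_mulg1 raag_mulVg raag_mulgV.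

End RightAngledArtin.

Section AffineGroup.
Variables (R : realType) (n : nat).

(* The pair (A, b), with A invertible, stands for the affine transformation
   x |-> A x + b of R^n. *)
Definition affine_group :=
  {p : 'M[R]_n * 'cV[R]_n | p.1 \in unitmx}.

HB.instance Definition _ := Choice.on affine_group.

Definition aff_act (f : affine_group) (x : 'cV[R]_n) : 'cV[R]_n :=
  (val f).1 *m x + (val f).2.

Definition aff_one : affine_group :=
  exist _ (1%:M, 0) (unitmx1 R n).

Fact aff_mul_subproof (f g : affine_group) :
  ((val f).1 *m (val g).1) \in unitmx.
Proof. by rewrite unitmx_mul (valP f) (valP g). Qed.

Definition aff_mul (f g : affine_group) : affine_group :=
  exist _ ((val f).1 *m (val g).1, (val f).1 *m (val g).2 + (val f).2)
    (aff_mul_subproof f g).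

Fact aff_inv_subproof (f : affine_group) : invmx (val f).1 \in unitmx.
Proof. by rewrite unitmx_inv (valP f). Qed.

Definition aff_inv (f : affine_group) : affine_group :=
  exist _ (invmx (val f).1, - (invmx (val f).1 *m (val f).2))
    (aff_inv_subproof f).

Lemma aff_act1 x : aff_act aff_one x = x.
Proof. by rewrite /aff_act /= mul1mx addr0. Qed.

Lemma aff_actM f g x : aff_act (aff_mul f g) x = aff_act f (aff_act g x).
Proof. by rewrite /aff_act /= mulmxDr mulmxA addrA. Qed.

Lemma aff_act_inj f g : aff_act f =1 aff_act g -> f = g.
Proof.
move=> fg; apply: val_inj.
have tE : (val f).2 = (val g).2.
  by have := fg 0; rewrite /aff_act !mulmx0 !add0r.
have lE : (val f).1 = (val g).1.
  apply/trmx_inj/row_matrixP => i.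
  have := fg (delta_mx i 0); rewrite /aff_act tE => /addIr.
  by rewrite -!colE -!tr_col => ->.
by move: tE lE; case: (val f) => A a; case: (val g) => B b /= -> ->.
Qed.

Fact aff_mulA : associative aff_mul.
Proof. by move=> f g h; apply: aff_act_inj => x; rewrite !aff_actM. Qed.

Fact aff_mul1g : left_id aff_one aff_mul.
Proof. by move=> f; apply: aff_act_inj => x; rewrite aff_actM aff_act1. Qed.

Fact aff_mulg1 : right_id aff_one aff_mul.
Proof. by move=> f; apply: aff_act_inj => x; rewrite aff_actM aff_act1. Qed.

Fact aff_mulVg : left_inverse aff_one aff_inv aff_mul.
Proof.
move=> f; apply: aff_act_inj => x; rewrite aff_actM aff_act1 /aff_act /=.
by rewrite mulmxDr mulKmx ?(valP f)// addrK.
Qed.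

Fact aff_mulgV : right_inverse aff_one aff_inv aff_mul.
Proof.
move=> f; apply: aff_act_inj => x; rewrite aff_actM aff_act1 /aff_act /=.
by rewrite mulmxDr mulmxN !mulKVmx ?(valP f)// subrK.
Qed.

HB.instance Definition _ := isGroup.Build affine_group
  aff_mulA aff_mul1g aff_mulg1 aff_mulVg aff_mulgV.

End AffineGroup.

Definition proper_affine_action (R : realType) (n : nat) (G : groupType)
    (rho : {multiplicative G -> affine_group R n}) : Prop :=
  forall C : set 'cV[R]_n, compact C ->
    finite_set [set g : G | (aff_act (rho g) @` C) `&` C !=set0].

(* Main.v *)
From HB Require Import structures.
Require Import Defs.
From mathcomp Require Import all_boot all_order all_algebra.
From mathcomp Require Import all_classical all_reals all_analysis.
From mathcomp Require Import ring lra.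

(** The action comes from a one-parameter family of linear representations
    rho_T of a right-angled Coxeter group W containing the right-angled Artin
    group, differentiated at T = 3.  If w acts by P = rho_T(w), with derivative
    D = d/dT rho_T(w), then over the dual numbers P + eps D acts by left
    multiplication on the cosets (1 + eps X) GL_k(R), where X runs over all
    k x k matrices: w sends X to the Y with Y P = P X + D.  This is an affine
    action on R^(k * k).  When X and Y stay in a compact set, the equation
    D = Y P - P X bounds |D| by a multiple of |P|.  So the action is proper as
    soon as |D| / |P| tends to infinity with the length of w: all elements of
    the group have to grow faster as T increases.

    For W take two reflections (v, true), (v, false) for each vertex v, where
    two reflections commute exactly when their vertices are joined; the vertex
    v is sent to the product (v, true) (v, false).  The representation rho_T is
    dual to the geometric representation of W with off-diagonal entries -T / 2:
    the reflection i maps a vector l to the one with l_i replaced by - l_i, and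
    T l_i added to l_j for each j that does not commute with i.  Following the
    all-one vector along a word is Mozes' numbers game, and the word is reduced
    when every firing happens at a positive entry ([growing]).  This holds for
    reduced words of the Artin group ([reduced_growing]): an entry is negative
    only if it was fired and no neighbour has been fired since
    ([growing_neighbour_gt0]), and then firing it again would cancel a letter.

    For a growing word let l be the final vector and l' its derivative in T.
    Each entry of row a of P is at most |l_a| in absolute value ([word_mx_le]),
    and |l_a| is at least the number of times a was fired ([growing_count]).
    What remains is that |l'_a| >= K |l_a| - C_K for each K, with C_K
    independent of the word.  This is proved by induction on K in steps of 1/6
    ([logderiv_ge_step]).  Firing i adds l_i + 3 l'_i to the derivative of the
    neighbouring entries, hence a surplus of l_i over three times the estimate
    at i.  When l_i is large the surplus pays for the step from K to K + 1/6,
    and l_i is small only a bounded number of times, since it grows each time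
    that i is fired. *)

Set Implicit Arguments.
Unset Strict Implicit.
Unset Printing Implicit Defensive.

Import Order.TTheory GRing.Theory Num.Theory.
Import numFieldNormedType.Exports.

(** * The numbers game of a right-angled Coxeter group *)

Section NumbersGame.
Local Open Scope ring_scope.
Variables (R : archiRealFieldType) (I : finType) (adj : rel I).
Hypotheses (adj_sym : symmetric adj) (adj_irr : irreflexive adj).
Implicit Types (f l : I -> R) (q C : R) (i j : I) (x : seq I).

(** The relation [adj] links the reflections that do not commute.  With [q = 0]
    this is the reflection at [i] for T = 3; with [q] the [i]-th entry of a
    vector depending on T, it is the rule for the derivative of that vector. *)
Definition fire f q i : I -> R := fun j =>
  if j == i then - f i else if adj i j then f j + 3 * f i + q else f j.

Definition play f x : I -> R := foldr (fun i g => fire g 0 i) f x.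

Definition score x := play (fun=> 1) x.

Arguments score : simpl never.

Lemma score_cons i x j : score (i :: x) j =
  if j == i then - score x i
  else if adj i j then score x j + 3 * score x i else score x j.
Proof. by rewrite /score /= /fire addr0. Qed.

(** The derivative of [score x] with respect to T, at T = 3. *)
Fixpoint dscore x : I -> R :=
  if x is i :: y then fire (dscore y) (score y i) i else fun=> 0.

Fixpoint growing x : bool :=
  if x is i :: y then growing y && (0 < score y i) else true.

(** Up to the error [C], the vector [f] has the signs of [l], and where [l] is
    negative the neighbouring entries of [f] still outweigh it.  The second
    condition is what makes the first one survive a firing: a negative entry
    next to a fired positive one becomes positive.  It is used with [l] a score
    and [f] a linear function of scores and their derivatives. *)
Definition aligned l f C := forall i,
  (0 < l i -> - C <= f i) /\
  (l i < 0 -> f i <= C /\ forall j, adj i j -> - C <= f i + f j).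

Lemma aligned_le l f C C' : C <= C' -> aligned l f C -> aligned l f C'.
Proof.
move=> CC' lf i; have [lf1 lf2] := lf i; split=> [/lf1|/lf2 [le ge]]; first lra.
by split=> [|j /ge]; lra.
Qed.

Lemma aligned_eq l f g C : f =1 g -> aligned l f C -> aligned l g C.
Proof.
move=> fg lf i; rewrite -fg; have [lf1 lf2] := lf i; split=> // /lf2 [le ge].
by split=> // j; rewrite -fg; exact: ge.
Qed.

(** Each quantity that has to be bounded after the firing is one that was
    bounded before, plus [m * f i + q] with [m] in 1, 2, 3.  For a neighbour
    [j] of [i] with [l j < 0] the old quantity is [f i + f j], so that no upper
    bound on [f i] is ever needed. *)
Lemma aligned_fire l f q C h i :
    (forall j, l j != 0) -> aligned l l 0 -> 0 < l i -> aligned l f C ->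
    0 <= h -> - h <= f i + q -> - h <= 2 * f i + q -> - h <= 3 * f i + q ->
  aligned (fire l 0 i) (fire f q i) (C + h).
Proof.
move=> l_neq0 ll li_gt0 lf h_ge0 h1 h2 h3 a.
have [fi _] := lf i; have {}fi := fi li_gt0.
rewrite /fire; case: (a =P i) => [->|/eqP a_neqi].
  split=> [|_]; first lra.
  split=> [|j adj_ij]; first lra.
  have /negPf -> : j != i by apply: contraTneq adj_ij => ->; rewrite adj_irr.
  rewrite adj_ij; have [lj_lt0|lj_gt0|lj0] := ltgtP (l j) 0.
  - have [_ /(_ lj_lt0) [_ /(_ i)]] := lf j.
    by rewrite adj_sym => /(_ adj_ij); lra.
  - by have [/(_ lj_gt0) + _] := lf j; lra.
  - by have := l_neq0 j; rewrite lj0 eqxx.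
case: ifPn => [adj_ia|nadj_ia].
  have [la_lt0|la_gt0|la0] := ltgtP (l a) 0.
  - have [_ /(_ la_lt0) [_ /(_ i)]] := ll a.
    rewrite adj_sym => /(_ adj_ia) lai.
    have [_ /(_ la_lt0) [_ /(_ i)]] := lf a.
    by rewrite adj_sym => /(_ adj_ia) fai; split; lra.
  - by have [/(_ la_gt0) + _] := lf a; split; lra.
  - by have := l_neq0 a; rewrite la0 eqxx.
have [lfa1 lfa2] := lf a; split=> [/lfa1|/lfa2 [fa faj]]; first lra.
split=> [|j adj_aj]; first lra.
have /negPf -> : j != i.
  by apply: contraNneq nadj_ia => <-; rewrite adj_sym.
by have := faj j adj_aj; case: ifP; lra.
Qed.

(** The weak inequality in the second clause excludes [l i = 0]. *)
Definition outgrows_count l x := forall i,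
  (0 < l i -> (count_mem i x).+1%:R <= l i) /\
  (l i <= 0 -> (0 < count_mem i x)%N /\ (count_mem i x)%:R <= - l i).

Lemma outgrows_count_neq0 l x : outgrows_count l x -> forall i, l i != 0.
Proof.
move=> lx i; apply/eqP => li0; have [_] := lx i.
by rewrite li0 lexx oppr0 lern0 => /(_ isT) [/lt0n_neq0/negPf ->].
Qed.

(** An entry which turns from [- a] to a positive value becomes at least [2 a],
    because the fired neighbour is at least [a].  This strict growth is the
    reason for taking T = 3: for T = 2 the value could come back to [a]. *)
Lemma growing_invariants x : growing x ->
  aligned (score x) (score x) 0 /\ outgrows_count (score x) x.
Proof.
elim: x => [_|i x IHx /= /andP [/IHx [xx bx]] xi_gt0].
  by split=> i; rewrite /score /=; split; lra.
have bx_neq0 := outgrows_count_neq0 bx.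
split.
  rewrite -[X in aligned _ _ X]addr0.
  by apply: (@aligned_fire (score x) (score x) 0 0 0 i) => //; lra.
move=> j; have [bj1 bj2] := bx j; rewrite score_cons /=.
rewrite [i == j]eq_sym; case: (j =P i) => [->|_].
  have [/(_ xi_gt0) bi1 _] := bx i.
  by rewrite oppr_gt0 ltNge ltW//; split=> // _; rewrite opprK add1n.
rewrite add0n; case: ifPn => // adj_ij.
have [xj_lt0|xj_gt0|xj0] := ltgtP (score x j) 0.
- have [cx cj] := bj2 (ltW xj_lt0); move: cx.
  have [_ /(_ xj_lt0) [_ /(_ i)]] := xx j; rewrite adj_sym => /(_ adj_ij) ji.
  rewrite -(ler_nat R) => cx; rewrite -addn1 natrD.
  by split; lra.
- by have := bj1 xj_gt0; split; lra.
- by have := bx_neq0 j; rewrite xj0 eqxx.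
Qed.

Lemma growing_neq0 x : growing x -> forall i, score x i != 0.
Proof. by move=> /growing_invariants [_ /outgrows_count_neq0]. Qed.

Lemma growing_count x i : growing x -> (count_mem i x)%:R <= `|score x i|.
Proof.
move=> /growing_invariants [_ /(_ i) [b1 b2]].
have [x_le0|x_gt0] := lerP (score x i) 0.
  by have [] := b2 x_le0; rewrite ler0_norm.
by have := b1 x_gt0; rewrite gtr0_norm// -addn1 natrD; lra.
Qed.

(** A negative entry is one whose last neighbouring firing was its own. *)
Lemma growing_neighbour_gt0 x i j :
  growing (i :: x) -> adj i j -> 0 < score (i :: x) j.
Proof.
move=> gx adj_ij; have [/(_ i) [_ +] _] := growing_invariants gx.
have := growing_neq0 gx j; move: gx => /= /andP [_].
rewrite [score (i :: x) i]score_cons eqxx => xi_gt0 xj_neq0.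
rewrite oppr_lt0 => /(_ xi_gt0) [_ /(_ j adj_ij)]; lra.
Qed.

Lemma growing_play f x : (forall i, 0 <= f i) -> growing x ->
  aligned (score x) (play f x) 0.
Proof.
move=> f_ge0; elim: x => [_|i x IHx /= /andP [gx xi_gt0]].
  by move=> i; have := f_ge0 i; rewrite /score /=; split; lra.
have [xx bx] := growing_invariants gx.
have IH := IHx gx; have [/(_ xi_gt0) fi _] := IH i.
have x_neq0 := outgrows_count_neq0 bx.
rewrite -[X in aligned _ _ X]addr0.
by apply: (@aligned_fire (score x) (play f x) 0 0 0 i) => //; lra.
Qed.

(** Along growing words, the logarithmic derivative of the score in T is at
    least [K], up to an additive error which does not depend on the word. *)
Definition logderiv_ge (K : R) := exists2 C, 0 <= C &
  forall x, growing x ->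
    aligned (score x) (fun i => dscore x i - K * score x i) C.

Lemma logderiv_ge0 : logderiv_ge 0.
Proof.
exists 0 => //.
suff H x : growing x -> aligned (score x) (dscore x) 0.
  move=> x /H H' i; have [H1 H2] := H' i; split=> [/H1|/H2 [le ge]]; first lra.
  by split=> [|j /ge]; lra.
elim: x => [_|i x IHx /= /andP [gx xi_gt0]].
  by move=> i; rewrite /score /=; split; lra.
have [xx bx] := growing_invariants gx.
have IH := IHx gx; have [/(_ xi_gt0) di _] := IH i.
have x_neq0 := outgrows_count_neq0 bx.
rewrite -[X in aligned _ _ X]addr0.
by apply: (@aligned_fire (score x) (dscore x) (score x i) 0 0 i) => //; lra.
Qed.

(** With [f] the vector [dscore - (K + 1/6) * score], a firing at [i] changes
    entries by [m * f i + score i], which is at least [score i / 2 - 3 C].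
    This is negative only while [score i] is below [6 C], hence during the first
    [B] firings of [i]; the total deficit is bounded by [3 C * #|I| * B]. *)
Lemma logderiv_ge_step K : 0 <= K -> logderiv_ge K -> logderiv_ge (K + 6^-1).
Proof.
move=> K_ge0 [C C_ge0 IHC].
pose B := Num.bound (6 * C).
have leB : 6 * C <= B%:R by apply/ltW; apply: archi_boundP; lra.
(* the number of firings in x that may have caused a deficit *)
pose loss x := (\sum_(i : I) minn (count_mem i x) B)%N.
have loss_le x : (loss x <= #|I| * B)%N.
  by rewrite -sum_nat_const leq_sum// => i _; apply: geq_minr.
have loss_cons i x : loss (i :: x) = (loss x + (count_mem i x < B))%N.
  rewrite /loss (bigD1 i)//=.
  rewrite (bigD1 i (F := fun i => minn (count_mem i x) B))//=.
  rewrite eqxx add1n addnAC; congr addn; last first.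
    apply: eq_bigr => j /negPf; by rewrite eq_sym => ->.
  have [cB|Bc] := ltnP.
    by rewrite (minn_idPl cB) addn1.
  by rewrite (minn_idPr (leqW Bc)) addn0.
exists (K + 6^-1 + 3 * C * (#|I| * B)%:R).
  by rewrite !addr_ge0 ?invr_ge0 ?mulr_ge0.
move=> x gx; apply: (@aligned_le _ _ (K + 6^-1 + 3 * C * (loss x)%:R)).
  by rewrite lerD2l ler_wpM2l ?ler_nat// mulr_ge0.
elim: x gx => [_ i|i x IHx /= /andP [gx xi_gt0]].
  have : 0 <= 3 * C * (loss [::])%:R by rewrite !mulr_ge0.
  by rewrite /score /=; split; lra.
have IH := IHx gx.
have [xx bx] := growing_invariants gx; have x_neq0 := outgrows_count_neq0 bx.
pose f j := dscore x j - (K + 6^-1) * score x j.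
apply: (@aligned_eq _ (fire f (score x i) i)).
  move=> j; rewrite score_cons /= /fire /f.
  by case: ifP => _; [|case: ifP => _]; lra.
pose h := 3 * C * (count_mem i x < B)%:R.
rewrite loss_cons natrD mulrDr addrA -/h.
have h_ge0 : 0 <= h by rewrite !mulr_ge0.
have fE : f i = (dscore x i - K * score x i) - 6^-1 * score x i.
  by rewrite /f; lra.
have [/(_ xi_gt0) fi _] := IHC x gx i.
have hP : 3 * C - 2^-1 * score x i <= h.
  rewrite /h; case: ltnP => [_|]; first by rewrite mulr1; lra.
  rewrite -(ler_nat R) => Bc.
  have := growing_count i gx; rewrite gtr0_norm// mulr0; lra.
by apply: (@aligned_fire (score x) f (score x i) _ h i) => //; rewrite fE; lra.
Qed.

Lemma logderiv_ge_nat n : logderiv_ge (n%:R / 6).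
Proof.
elim: n => [|n IHn]; first by rewrite mul0r; exact: logderiv_ge0.
by rewrite -natr1 mulrDl mul1r; apply: logderiv_ge_step => //; apply: divr_ge0.
Qed.

Lemma size_sum_count x : size x = (\sum_i count_mem i x)%N.
Proof.
elim: x => [|j x IHx] /=; first by rewrite big1.
rewrite big_split /= -IHx (bigD1 j)//= eqxx big1 ?addn0// => i.
by rewrite eq_sym => /negPf ->.
Qed.

(** A bounded ratio of derivative and value, at the largest entry, bounds that
    value by the error in [logderiv_ge (K + 1)], hence all the counts. *)
Lemma growing_size_le (K : R) : 0 <= K -> exists L : nat, forall x i,
  growing x -> (forall j, `|score x j| <= `|score x i|) ->
  `|dscore x i| <= K * `|score x i| -> (size x <= L)%N.
Proof.
move=> K_ge0.
pose n := Num.bound (6 * (K + 1)).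
have nK : K + 1 <= n%:R / 6.
  have : 6 * (K + 1) < n%:R by apply: archi_boundP; lra.
  by lra.
have [C C_ge0 HC] := logderiv_ge_nat n.
exists (Num.bound (#|I|%:R * C)) => x i gx max_i le_i.
have score_le_C : `|score x i| <= C.
  suff : n%:R / 6 * `|score x i| - C <= `|dscore x i|.
    have : (K + 1) * `|score x i| <= n%:R / 6 * `|score x i|.
      exact: ler_wpM2r.
    by lra.
  have [H1 H2] := HC x gx i.
  have [x_gt0|x_lt0|x0] := ltgtP 0 (score x i).
  - rewrite (gtr0_norm x_gt0); have := H1 x_gt0.
    by have := ler_norm (dscore x i); lra.
  - rewrite (ltr0_norm x_lt0); have [+ _] := H2 x_lt0.
    by have := ler_norm (- dscore x i); rewrite normrN; lra.
  - by have := growing_neq0 gx i; rewrite -x0 eqxx.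
rewrite -(ler_nat R); apply/ltW.
apply: le_lt_trans (archi_boundP _); last by rewrite mulr_ge0.
rewrite size_sum_count natr_sum mulr_natl -sumr_const.
apply: ler_sum => j _; apply: le_trans score_le_C.
exact: le_trans (growing_count j gx) (max_i j).
Qed.

End NumbersGame.

Arguments score {R I} adj x _ : simpl never.
Arguments dscore {R I} adj x _.

(** * The affine action of a first-order deformation *)

Section JetAction.
Local Open Scope ring_scope.
Variables (R : realType) (k : nat).
Implicit Types (P Q D E : 'M[R]_k) (f g : affine_group R (k * k)).

Definition unvec (x : 'cV[R]_(k * k)) : 'M[R]_k := vec_mx x^T.

Lemma unvec_inj : injective unvec.
Proof. by move=> x y /(can_inj (@vec_mxK _ _ _)) /trmx_inj. Qed.

Lemma unvecE x a b : unvec x a b = x (mxvec_index a b) 0.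
Proof. by rewrite !mxE. Qed.

(** The affine map [f] acts as the matrix [P + eps D] over the dual numbers does
    on the cosets of [1 + eps X], namely (P + eps D)(1 + eps X) =
    (1 + eps Y) P.  Stated as an equation without inverses, it is compatible
    with products and determines [f], so that relations between affine maps
    follow from relations between matrices. *)
Definition implements f P D :=
  forall x, unvec (aff_act f x) *m P = P *m unvec x + D.

Lemma implements1 : implements (aff_one R (k * k)) 1%:M 0.
Proof. by move=> x; rewrite aff_act1 mulmx1 mul1mx addr0. Qed.

Lemma implementsM f g P Q D E : implements f P D -> implements g Q E ->
  implements (aff_mul f g) (P *m Q) (D *m Q + P *m E).
Proof.
move=> fP gQ x; rewrite aff_actM mulmxA fP mulmxDl -mulmxA gQ mulmxDr mulmxA.
by rewrite -addrA [P *m E + _]addrC.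
Qed.

Lemma implements_inj f g P D : P \in unitmx ->
  implements f P D -> implements g P D -> f = g.
Proof.
move=> uP fP gP; apply: aff_act_inj => x; apply: unvec_inj.
by apply: (can_inj (mulmxK uP)); rewrite fP gP.
Qed.

Section Involution.
Variables (P D : 'M[R]_k) (PP : P *m P = 1%:M).

Let lin := lin_mx (mulmx P \o mulmxr P).

Fact jet_aff_subproof : lin^T \in unitmx.
Proof.
suff: lin *m lin = 1%:M by rewrite unitmx_tr => /mulmx1_unit [].
apply/row_matrixP => i; rewrite !rowE mulmx1 mulmxA.
set u := delta_mx _ _; rewrite -[u]vec_mxK !mul_vec_lin /=.
by rewrite -!mulmxA PP mulmx1 mulmxA PP mul1mx.
Qed.

Definition jet_aff : affine_group R (k * k) :=
  exist _ (lin^T, (mxvec (D *m P))^T) jet_aff_subproof.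

Lemma jet_affP : implements jet_aff P D.
Proof.
move=> x; rewrite /unvec /aff_act /= linearD /= trmx_mul !trmxK.
rewrite -[x^T in LHS]vec_mxK mul_vec_lin /= -linearD mxvecK /= mulmxDl.
by rewrite -!mulmxA PP !mulmx1.
Qed.

End Involution.
End JetAction.

(** * Affine reflections and their products *)

Section Reflections.
Local Open Scope ring_scope.
Variables (R : realType) (k : nat) (adj : rel 'I_k).
Hypotheses (adj_sym : symmetric adj) (adj_irr : irreflexive adj).
Implicit Types (i j : 'I_k) (x : seq 'I_k) (M E : 'M[R]_k).

Definition refl_mx i : 'M[R]_k := 1%:M +
  (\col_j (if j == i then -2 else if adj i j then 3 else 0)) *m delta_mx 0 i.

Definition drefl_mx i : 'M[R]_k := (\col_j (adj i j)%:R) *m delta_mx 0 i.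

Lemma refl_mx_mulE i n (M : 'M[R]_(k, n)) a c :
  (refl_mx i *m M) a c = fire adj (fun j => M j c) 0 i a.
Proof.
rewrite mulmxDl mul1mx -mulmxA -rowE mxE [X in _ + X]mxE big_ord1 !mxE /fire.
by case: (a =P i) => [->|_]; [|case: ifP => _]; ring.
Qed.

Lemma drefl_mx_mulE i n (E M : 'M[R]_(k, n)) a c :
  (drefl_mx i *m M + refl_mx i *m E) a c =
  fire adj (fun j => E j c) (M i c) i a.
Proof.
rewrite mxE refl_mx_mulE -mulmxA -rowE [X in X + _]mxE big_ord1 !mxE /fire.
case: (a =P i) => [->|_]; first by rewrite adj_irr mul0r add0r.
by case: ifP => _; [rewrite mul1r|rewrite mul0r]; ring.
Qed.

Lemma refl_mxE i a c : refl_mx i a c = fire adj (fun j => 1%:M j c) 0 i a.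
Proof. by rewrite -[refl_mx i]mulmx1 refl_mx_mulE. Qed.

Lemma drefl_mxE i a c : drefl_mx i a c = fire adj (fun=> 0) (1%:M i c) i a.
Proof.
have := drefl_mx_mulE i 0 1%:M a c; rewrite mulmx0 mulmx1 addr0 => ->.
by rewrite /fire !mxE.
Qed.

Lemma refl_mx_sq i : refl_mx i *m refl_mx i = 1%:M.
Proof.
apply/matrixP => a c; rewrite refl_mx_mulE /fire !refl_mxE /fire eqxx.
case: (a =P i) => [->|_]; first by rewrite opprK.
by case: (adj i a); ring.
Qed.

Lemma refl_mx_unit i : refl_mx i \in unitmx.
Proof. by have [] := mulmx1_unit (refl_mx_sq i). Qed.

Lemma drefl_mx_sq i : drefl_mx i *m refl_mx i + refl_mx i *m drefl_mx i = 0.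
Proof.
apply/matrixP => a c; rewrite drefl_mx_mulE [RHS]mxE /fire.
rewrite !drefl_mxE refl_mxE /fire eqxx.
case: (a == i); first by rewrite !oppr0.
by case: (adj i a); ring.
Qed.

Lemma refl_mx_comm i j : i != j -> ~~ adj i j ->
  refl_mx i *m refl_mx j = refl_mx j *m refl_mx i.
Proof.
move=> ij nij; have nji : ~~ adj j i by rewrite adj_sym.
have ji : j != i by rewrite eq_sym.
apply/matrixP => a c; rewrite !refl_mx_mulE /fire !refl_mxE /fire.
rewrite !(negPf ij) !(negPf ji) !(negPf nij) !(negPf nji).
case: (a =P i) => [->|_]; first by rewrite (negPf ij) (negPf nji).
case: (a =P j) => [->|_]; first by rewrite (negPf nij).
by case: (adj i a); case: (adj j a); ring.
Qed.

Lemma drefl_mx_comm i j : i != j -> ~~ adj i j ->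
  drefl_mx i *m refl_mx j + refl_mx i *m drefl_mx j =
  drefl_mx j *m refl_mx i + refl_mx j *m drefl_mx i.
Proof.
move=> ij nij; have nji : ~~ adj j i by rewrite adj_sym.
have ji : j != i by rewrite eq_sym.
apply/matrixP => a c; rewrite !drefl_mx_mulE /fire !refl_mxE !drefl_mxE /fire.
rewrite !(negPf ij) !(negPf ji) !(negPf nij) !(negPf nji).
case: (a =P i) => [->|_]; first by rewrite (negPf ij) (negPf nji).
case: (a =P j) => [->|_]; first by rewrite (negPf nij).
by case: (adj i a); case: (adj j a); ring.
Qed.

Definition refl_aff i : affine_group R (k * k) :=
  jet_aff (drefl_mx i) (refl_mx_sq i).

Local Open Scope group_scope.

Lemma refl_affK i : refl_aff i * refl_aff i = 1.
Proof.
have iP := jet_affP (drefl_mx i) (refl_mx_sq i).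
apply: (@implements_inj _ _ _ _ 1%:M 0); first exact: unitmx1.
  by have := implementsM iP iP; rewrite refl_mx_sq drefl_mx_sq.
exact: implements1.
Qed.

Lemma refl_aff_comm i j : ~~ adj i j -> commute (refl_aff i) (refl_aff j).
Proof.
have [->//|ij nij] := eqVneq i j.
have iP := jet_affP (drefl_mx i) (refl_mx_sq i).
have jP := jet_affP (drefl_mx j) (refl_mx_sq j).
have ijP := implementsM iP jP; have jiP := implementsM jP iP.
apply: implements_inj ijP _.
  by rewrite unitmx_mul !refl_mx_unit.
by rewrite refl_mx_comm// drefl_mx_comm.
Qed.

Fixpoint word_mx x : 'M[R]_k :=
  if x is i :: y then refl_mx i *m word_mx y else 1%:M.

Fixpoint dword_mx x : 'M[R]_k :=
  if x is i :: y then (drefl_mx i *m word_mx y + refl_mx i *m dword_mx y)%R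
  else 0%R.

Lemma implements_word x :
  implements (\prod_(i <- x) refl_aff i) (word_mx x) (dword_mx x).
Proof.
elim: x => [|i x IHx]; first by rewrite big_nil; exact: implements1.
by rewrite big_cons; apply: implementsM (jet_affP _ _) IHx.
Qed.

Local Open Scope ring_scope.

Lemma word_mx_play x (v : 'cV[R]_k) a :
  (word_mx x *m v) a 0 = play adj (fun j => v j 0) x a.
Proof.
elim: x a => [|i x IHx] a /=; first by rewrite mul1mx.
by rewrite -mulmxA refl_mx_mulE /fire !IHx.
Qed.

Lemma word_mx_score x a :
  (word_mx x *m (const_mx 1 : 'cV_k)) a 0 = score adj x a :> R.
Proof.
rewrite word_mx_play /score; congr (play _ _ x a).
by apply/funext => j; rewrite mxE.
Qed.

Lemma dword_mx_dscore x a :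
  (dword_mx x *m (const_mx 1 : 'cV_k)) a 0 = dscore adj x a :> R.
Proof.
elim: x a => [|i x IHx] a /=; first by rewrite mul0mx mxE.
rewrite mulmxDl -(mulmxA (drefl_mx i)) -(mulmxA (refl_mx i)).
by rewrite drefl_mx_mulE /fire !IHx word_mx_score.
Qed.

(** All nonnegative initial vectors produce the signs of the score.  Hence the
    entries of row [a] have a common sign, and they add up to the score at
    [a], the image of the all-one vector. *)
Lemma word_mx_le x a b : growing R adj x ->
  `|word_mx x a b| <= `|score adj x a| :> R.
Proof.
move=> gx; pose v := delta_mx b 0 : 'cV[R]_k.
have v01 j : 0 <= v j 0 <= 1.
  by rewrite mxE andbT; case: (_ == _); rewrite ler01 lexx.
have vE : word_mx x a b = play adj (fun j => v j 0) x a.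
  by rewrite -word_mx_play -colE mxE.
have v'E : score adj x a - word_mx x a b
         = play adj (fun j => (const_mx 1 - v : 'cV_k) j 0) x a.
  by rewrite -word_mx_play mulmxBr mxE word_mx_score mxE -colE mxE.
have [|H1 H2] := @growing_play _ _ _ adj_sym adj_irr (fun j => v j 0) x _ gx a.
  by move=> j; have /andP [] := v01 j.
have [|H3 H4] := @growing_play _ _ _ adj_sym adj_irr
  (fun j => (const_mx 1 - v : 'cV_k) j 0) x _ gx a.
  by move=> j; rewrite !mxE subr_ge0; have /andP [] := v01 j; rewrite mxE.
rewrite -vE -v'E in H1 H2 H3 H4.
have [x_gt0|x_lt0|x0] := ltgtP 0 (score adj x a : R).
- have := H1 x_gt0; have := H3 x_gt0; rewrite oppr0 => h3 h1.
  by rewrite !ger0_norm//; lra.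
- have [h2 _] := H2 x_lt0; have [h4 _] := H4 x_lt0.
  by rewrite !ler0_norm//; lra.
- by have := growing_neq0 adj_sym adj_irr gx a; rewrite -x0 eqxx.
Qed.

(** Apply the equation D = Y P - P X to the all-one vector, at an index [i]
    where the score is largest: the entries of row [i] of P and of the image of
    the all-one vector are bounded by that score, those of X and Y by [M]. *)
Lemma displacement_le x (M : R) (u : 'cV[R]_(k * k)) i : growing R adj x ->
    let y := aff_act (\prod_(j <- x) refl_aff j)%g u in
    (forall a, `|u a 0| <= M) -> (forall a, `|y a 0| <= M) ->
    (forall j, `|score adj x j| <= `|score adj x i| :> R) ->
  `|dscore adj x i| <= (k%:R + k%:R * k%:R) * M * `|score adj x i|.
Proof.
move=> gx y uM yM i_max.
have := implements_word x u; rewrite -/y.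
move=> /(congr1 (fun A => (A *m const_mx 1 : 'cV_k) i 0)).
rewrite mulmxDl [RHS]mxE dword_mx_dscore -!mulmxA.
move=> /esym /(canRL (addKr _)) ->.
apply: (le_trans (ler_normD _ _)); rewrite normrN addrC !mulrDl.
apply: lerD.
  rewrite mxE; apply: (le_trans (ler_norm_sum _ _ _)).
  rewrite -mulrA mulr_natl -[k in _ *+ k]card_ord -sumr_const.
  apply: ler_sum => j _; rewrite word_mx_score normrM unvecE.
  exact: ler_pM.
rewrite mxE; apply: (le_trans (ler_norm_sum _ _ _)).
rewrite -!mulrA mulr_natl -[k in _ *+ k]card_ord -sumr_const.
apply: ler_sum => j _; rewrite normrM mulrA [leRHS]mulrC.
apply: ler_pM => //; first exact: word_mx_le.
rewrite mxE; apply: (le_trans (ler_norm_sum _ _ _)).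
rewrite mulr_natl -[k in _ *+ k]card_ord -sumr_const.
by apply: ler_sum => l _; rewrite [const_mx _ _ _]mxE mulr1 unvecE.
Qed.

End Reflections.

(** * The universal property of a right-angled Artin group *)

Section UniversalProperty.
Variables (V : finType) (e : rel V) (G : groupType) (phi : V -> G).
Hypothesis phi_comm : forall u v, e u v -> commute (phi u) (phi v).
Local Open Scope group_scope.

Definition wprod (w : word V) : G :=
  \prod_(x <- w) (if x.2 then phi x.1 else (phi x.1)^-1).

Lemma wprod_cat w1 w2 : wprod (w1 ++ w2) = wprod w1 * wprod w2.
Proof. exact: big_cat. Qed.

Lemma wprod_cong w1 w2 : word_cong e w1 w2 -> wprod w1 = wprod w2.
Proof.
elim=> {w1 w2} [//|w1 w2 _ ->//|w1 w2 w3 _ -> _ ->//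
  |w1 w2 w1' w2' _ IH1 _ IH2|v b|u v uv].
- by rewrite !wprod_cat IH1 IH2.
- rewrite /wprod !big_cons !big_nil mulg1 /=.
  by case: b; rewrite ?mulgV ?mulVg.
- by rewrite /wprod !big_cons !big_nil !mulg1 /=; exact: phi_comm.
Qed.

(** The commutation hypothesis is an argument of the map, so that the map
    determines its structure of morphism. *)
Definition raag_lift of (forall u v, e u v -> commute (phi u) (phi v)) :=
  fun g : raag e => wprod (repr g).

Lemma raag_lift_pi w : raag_lift phi_comm (\pi_(raag e)%qT w) = wprod w.
Proof. exact: wprod_cong (word_cong_repr e w). Qed.

Fact raag_lift_morph : {morph raag_lift phi_comm : g h / g * h}.
Proof. by move=> g h; rewrite -wprod_cat -raag_lift_pi. Qed.

HB.instance Definition _ :=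
  isMultiplicative.Build (raag e) G (raag_lift phi_comm) raag_lift_morph.

End UniversalProperty.

(** * Reduced words *)

Section Reduced.
Variables (V : finType) (e : rel V).
Implicit Types (w : word V) (u v : V) (b c : bool).

Definition reduced w := forall w', word_cong e w w' -> (size w <= size w')%N.

Lemma exists_reduced (g : raag e) :
  exists2 w, reduced w & g = \pi_(raag e)%qT w.
Proof.
pose P n := `[< exists2 w, size w = n & g = \pi_(raag e)%qT w >].
have exP : exists n, P n.
  by exists (size (repr g)); apply/asboolP; exists (repr g); rewrite ?reprK.
case: (ex_minnP exP) => n /asboolP [w <- gw] n_min; exists w => // w' ww'.
apply: n_min; apply/asboolP; exists w' => //; rewrite gw.
by apply/eqP/raag_eqP.
Qed.

Lemma word_cong_cons x w w' :
  word_cong e w w' -> word_cong e (x :: w) (x :: w').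
Proof. exact: (word_cong_cat (word_cong_refl e [:: x])). Qed.

Lemma reduced_behead x w : reduced (x :: w) -> reduced w.
Proof. by move=> xw w' /(word_cong_cons x) /xw. Qed.

Lemma word_cong_swap u v b c : e u v ->
  word_cong e [:: (u, b); (v, c)] [:: (v, c); (u, b)].
Proof.
pose g x : raag e := \pi_(raag e)%qT [:: (x, true)].
have gV x : (g x)^-1%g = \pi_(raag e)%qT [:: (x, false)].
  apply: mulg1_eq; rewrite [LHS]raag_mul_pi.
  by apply/eqP/raag_eqP; exact: (word_cong_cancel e x true).
move=> euv; have uv : commute (g u) (g v).
  rewrite /commute [LHS]raag_mul_pi [RHS]raag_mul_pi.
  by apply/eqP/raag_eqP; exact: word_cong_comm.
have gE x d : \pi_(raag e)%qT [:: (x, d)] = (if d then g x else (g x)^-1)%g.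
  by case: d; rewrite ?gV.
apply/raag_eqP/eqP.
rewrite -[LHS](raag_mul_pi e [:: (u, b)] [:: (v, c)]).
rewrite -[RHS](raag_mul_pi e [:: (v, c)] [:: (u, b)]) !gE.
suff : commute (if b then g u else (g u)^-1)%g (if c then g v else (g v)^-1)%g.
  by [].
by case: b; case: c; do ?[exact: uv | apply: commuteV | apply: commute_sym].
Qed.

Lemma word_cong_rot v b w : (forall x, x \in w -> e v x.1) ->
  word_cong e ((v, b) :: w) (rcons w (v, b)).
Proof.
elim: w => [|[u c] w IHw] vw; first exact: word_cong_refl.
apply: (@word_cong_trans _ _ _ [:: (u, c), (v, b) & w]).
  apply: (@word_cong_cat _ _ [:: _; _] _ [:: _; _]); last exact: word_cong_refl.
  by apply: word_cong_swap; apply: (vw (u, c)); rewrite mem_head.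
by apply/word_cong_cons/IHw => x xw; apply: vw; rewrite inE xw orbT.
Qed.

Lemma reduced_cancel v b w1 w2 : (forall x, x \in w1 -> e v x.1) ->
  ~ reduced ((v, b) :: w1 ++ (v, ~~ b) :: w2).
Proof.
move=> vw /(_ (w1 ++ w2)); rewrite /= !size_cat /= addnS => H.
suff /H : word_cong e ((v, b) :: w1 ++ (v, ~~ b) :: w2) (w1 ++ w2).
  by rewrite ltnNge leqW.
apply: (@word_cong_trans _ _ _ (rcons w1 (v, b) ++ (v, ~~ b) :: w2)).
  rewrite -cat_cons; apply: word_cong_cat (word_cong_refl _ _).
  exact: word_cong_rot.
rewrite cat_rcons; apply: word_cong_cat; first exact: word_cong_refl.
apply: (@word_cong_cat _ _ [:: _; _] _ [::]); last exact: word_cong_refl.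
exact: word_cong_cancel.
Qed.

End Reduced.

(** * Embedding into the Coxeter group and properness *)

Local Open Scope ring_scope.

Lemma compact_coord_bounded (R : realType) n (C : set 'cV[R]_n) : compact C ->
  exists M, forall x a, C x -> `|x a 0| <= M.
Proof.
move=> cC.
have H a : exists M, forall x, C x -> `|x a 0| <= M.
  have : compact ((fun x : 'cV[R]_n => x a 0) @` C).
    apply: continuous_compact => //; apply: continuous_subspaceT.
    exact: coord_continuous.
  move=> /compact_bounded [M [_ MP]]; exists (M + 1) => x Cx.
  by apply: (MP (M + 1)); [rewrite ltrDl|exists x].
have [M MP] := choice H.
exists (\sum_a `|M a|) => x a Cx; apply: (le_trans (MP a x Cx)).
apply: (le_trans (ler_norm _)).
by rewrite (bigD1 a)//= lerDl sumr_ge0.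
Qed.

Section Doubling.
Variables (V : finType) (e : rel V) (e_sym : symmetric e).
(* The index None carries a reflection that no word uses and that commutes with
   all others; it makes the dimension positive when the graph is empty. *)
Local Notation I := (option (V * bool)).
Local Notation k := #|{: I}|.

Definition linked : rel I := fun x y =>
  if (x, y) is (Some (u, b), Some (v, c)) then
    if u == v then b != c else ~~ e u v
  else false.

Definition adj : rel 'I_k := fun i j => linked (enum_val i) (enum_val j).

Lemma adj_sym : symmetric adj.
Proof.
move=> i j; rewrite /adj.
case: (enum_val i) (enum_val j) => [[u b]|] [[v c]|] //=.
by rewrite /linked eq_sym [b == c]eq_sym e_sym.
Qed.

Lemma adj_irr : irreflexive adj.
Proof.
by move=> i; rewrite /adj; case: enum_val => [[u b]|] //; rewrite /linked !eqxx.
Qed.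

Definition vertex (x : V * bool) : 'I_k := enum_rank (Some x).

Lemma adj_vertex u b v c :
  adj (vertex (u, b)) (vertex (v, c)) = if u == v then b != c else ~~ e u v.
Proof. by rewrite /adj /vertex !enum_rankK. Qed.

(** A letter fires its two reflections, those of [v] and of its inverse being in
    opposite orders; the reflection named by the letter fires last and has the
    negative entry afterwards. *)
Fixpoint double (w : word V) : seq 'I_k :=
  if w is x :: w' then [:: vertex x, vertex (x.1, ~~ x.2) & double w']
  else [::].

Lemma size_double w : size (double w) = (size w).*2.
Proof. by elim: w => //= x w ->. Qed.

Variable R : realType.
Local Open Scope ring_scope.

(** The negative entry was made negative by its own letter, and no later letter
    has fired a neighbour, so that all later letters commute with it. *)
Lemma double_lt0 w v b : growing R adj (double w) ->
    score adj (double w) (vertex (v, b)) < 0 :> R ->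
  exists w1 w2, w = w1 ++ (v, b) :: w2 /\ forall x, x \in w1 -> e v x.1.
Proof.
elim: w => [_|[u c] w IHw gw]; first by rewrite /score /= ltr10.
have /andP [/andP [gw' _] _] := gw.
have [[-> ->] _|neq] := eqVneq (u, c) (v, b); first by exists [::], w.
have [adj_uv|] := boolP (adj (vertex (u, c)) (vertex (v, b))).
  rewrite ltNge ltW//.
  by apply: growing_neighbour_gt0 gw adj_uv; [exact: adj_sym|exact: adj_irr].
rewrite adj_vertex; case: (u =P v) neq => [->|/eqP uv] neq.
  by rewrite xpair_eqE eqxx /= in neq; rewrite neq.
rewrite negbK => euv; rewrite /= !score_cons.
rewrite !adj_vertex /= (negPf uv) euv /=.
rewrite !(inj_eq enum_rank_inj) !(inj_eq Some_inj) !xpair_eqE.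
rewrite eq_sym (negPf uv) /=.
move=> /(IHw gw') [w1 [w2 [-> w1P]]]; exists ((u, c) :: w1), w2; split=> // x.
by rewrite inE => /predU1P [->/=|/w1P//]; rewrite e_sym.
Qed.

(** The first reflection of a new letter fires at a positive entry, since
    otherwise the letter would cancel against an earlier inverse; the second
    one does because its neighbour has just been fired. *)
Lemma reduced_growing w : reduced e w -> growing R adj (double w).
Proof.
elim: w => [//|[v b] w IHw rw /=].
have gw := IHw (reduced_behead rw); rewrite gw /=.
have v_gt0 : 0 < score adj (double w) (vertex (v, ~~ b)) :> R.
  rewrite lt_neqAle eq_sym growing_neq0//=; last first.
  - exact: adj_irr.
  - exact: adj_sym.
  rewrite leNgt; apply/negP => /(double_lt0 gw) [w1 [w2 [wE w1P]]].
  by have := @reduced_cancel V e v b w1 w2 w1P; rewrite -wE.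
rewrite v_gt0; apply: growing_neighbour_gt0; [exact: adj_sym|exact: adj_irr| |].
  by rewrite /= gw v_gt0.
by rewrite adj_vertex eqxx; case: (b).
Qed.

Local Open Scope group_scope.

Definition generator_aff (v : V) : affine_group R (k * k) :=
  refl_aff R adj (vertex (v, true)) * refl_aff R adj (vertex (v, false)).

Lemma generator_aff_comm u v :
  e u v -> commute (generator_aff u) (generator_aff v).
Proof.
move=> euv; have [->//|uv] := eqVneq u v.
have H b c : commute (refl_aff R adj (vertex (u, b)))
                     (refl_aff R adj (vertex (v, c))).
  apply: refl_aff_comm; [exact: adj_sym|exact: adj_irr|].
  by rewrite adj_vertex (negPf uv) euv.
by apply: commuteM; apply/commute_sym/commuteM; apply/commute_sym.
Qed.

Lemma wprod_double w :
  wprod generator_aff w = \prod_(i <- double w) refl_aff R adj i.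
Proof.
elim: w => [|[v b] w IHw]; first by rewrite /wprod !big_nil.
rewrite /wprod big_cons -/(wprod generator_aff w) IHw /= !big_cons mulgA.
congr (_ * _).
have K i := mulg1_eq (refl_affK R adj_irr i).
case: b => //=; last by rewrite /generator_aff invgM !K.
Qed.

Local Open Scope ring_scope.

Lemma proper_generator_aff :
  proper_affine_action (raag_lift generator_aff_comm).
Proof.
move=> C cC; have [M CM] := compact_coord_bounded cC.
pose K : R := (k%:R + k%:R * k%:R) * `|M|.
have [|L LP] := @growing_size_le R _ adj adj_sym adj_irr K.
  by rewrite mulr_ge0 ?addr_ge0 ?mulr_ge0.
pose f (w : L.-bseq (V * bool)%type) : raag e := \pi_(raag e)%qT (w : seq _).
apply: (@sub_finite_set _ _ (range f)); last first.
  by apply: finite_image; exact: finite_finset.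
move=> g [_ [[x Cx <-] Cgx]].
have [w rw gE] := exists_reduced g.
have gw := reduced_growing rw.
suff wL : (size w <= L)%N by exists (Bseq wL) => //; rewrite gE.
have rhoE : raag_lift generator_aff_comm g =
    (\prod_(i <- double w) refl_aff R adj i)%g.
  by rewrite gE raag_lift_pi wprod_double.
move: Cgx; rewrite /= rhoE => Cgx.
have i0 : 'I_k := enum_rank None.
case: (@arg_maxP _ _ _ i0 predT (fun i => `|score adj (double w) i| : R)) => //.
move=> i _ i_max.
have := LP (double w) i gw (fun j => i_max j isT); rewrite size_double => wL.
suff /wL : `|dscore adj (double w) i| <= K * `|score adj (double w) i| :> R.
  by apply: leq_trans; rewrite -addnn leq_addr.
apply: (@displacement_le _ _ _ adj_sym adj_irr _ _ x) => // [a|a|j].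
- by apply: le_trans (CM x a Cx) (ler_norm _).
- by apply: le_trans (CM _ a Cgx) (ler_norm _).
- exact: i_max.
Qed.

End Doubling.

Theorem corollary1p2 (R : realType) (V : finType) (e : rel V)
    (e_sym : symmetric e) (e_irr : irreflexive e) :
  exists n : nat, (1 <= n)%N /\
    exists rho : {multiplicative raag e -> affine_group R n},
      proper_affine_action rho.
Proof.
exists (#|{: option (V * bool)}| * #|{: option (V * bool)}|)%N; split.
  by rewrite muln_gt0 andbb; apply/card_gt0P; exists None.
exists (raag_lift (generator_aff_comm e_sym R)); exact: proper_generator_aff.
Qed.
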